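(* If a function $f \colon \mathbb{N}\setminus\{0\} \to \mathbb{N}\setminus\{0\}$ has a single-fold Diophantine representation, then there exists a positive integer $m$ such that $f(n)<\xi(n)$ for every integer $n>m$.
   Context: $\mathbb{N}$ denotes the non-negative integers. For a positive integer $n$, let $B_n=\{x_i \cdot x_j=x_k,\ x_i+1=x_k : i,j,k \in \{1,\ldots,n\}\}$, a finite set of equations in the variables $x_1,\ldots,x_n$ (the indices need not be distinct). For a positive integer $n$, $\xi(n)$ denotes the smallest positive integer $b$ such that for each system $\mathcal{S} \subseteq B_n$ with a unique solution in positive integers $x_1,\ldots,x_n$, this solution belongs to $[1,b]^n$. A set $\mathcal{M}\subseteq \mathbb{N}^n$ has a single-fold Diophantine representation if there is a polynomial $W$ with integer coefficients such that for all $a_1,\ldots,a_n\in\mathbb{N}$: $(a_1,\ldots,a_n)\in\mathcal{M}$ if and only if there exist $x_1,\ldots,x_m\in\mathbb{N}$ with $W(a_1,\ldots,a_n,x_1,\ldots,x_m)=0$, and moreover for all $a_1,\ldots,a_n\in\mathbb{N}$ the equation $W(a_1,\ldots,a_n,x_1,\ldots,x_m)=0$ has at most one solution $(x_1,\ldots,x_m)\in\mathbb{N}^m$. A function $f \colon \mathbb{N}\setminus\{0\} \to \mathbb{N}\setminus\{0\}$ is identified with its graph $\{(a,f(a)) : a\in\mathbb{N}\setminus\{0\}\}\subseteq\mathbb{N}^2$, and has a single-fold Diophantine representation if its graph does. *)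

(* Defs.v *)
From HB Require Import structures.
From mathcomp Require Import all_boot all_order all_algebra.
From mathcomp Require Import boolp mpoly.

Set Implicit Arguments.
Unset Strict Implicit.
Unset Printing Implicit Defensive.

Import GRing.Theory.

(* [inl (i, j, k)] encodes the equation x_i * x_j = x_k and [inr (i, k)]
   encodes x_i + 1 = x_k, with 0-based indices; the whole type is B_n. *)
Definition eqn (n : nat) : finType := ('I_n * 'I_n * 'I_n + 'I_n * 'I_n)%type.

Definition eqn_holds (n : nat) (x : {ffun 'I_n -> nat}) (e : eqn n) : Prop :=
  match e with
  | inl (i, j, k) => x i * x j = x k
  | inr (i, k) => x i + 1 = x k
  end.

Definition pos_solution (n : nat) (S : {set eqn n}) (x : {ffun 'I_n -> nat}) :
    Prop :=
  (forall i, 0 < x i) /\ (forall e, e \in S -> eqn_holds x e).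

Definition bounds_unique_solutions (n b : nat) : Prop :=
  0 < b /\
  forall (S : {set eqn n}) (x : {ffun 'I_n -> nat}),
    unique (pos_solution S) x -> forall i, 1 <= x i <= b.

Lemma bounds_unique_solutions_exists (n : nat) :
  exists b, `[< bounds_unique_solutions n b >].
Proof.
have bS (S : {set eqn n}) : exists b, forall x : {ffun 'I_n -> nat},
    unique (pos_solution S) x -> forall i, x i <= b.
  have [[x [_ xU]]|noU] := pselect (exists x, unique (pos_solution S) x).
    exists (\max_i x i) => y [yS _] i; rewrite -(xU _ yS).
    exact: (leq_bigmax i).
  by exists 0 => x xU; case: noU; exists x.
have [b bP] := fin_all_exists bS.
exists (\max_S b S).+1; apply/asboolP; split=> // S x xU i.
have [[x0 _] _] := xU; rewrite x0 /=.
exact: leq_trans (bP S x xU i) (leqW (leq_bigmax S)).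
Qed.

Definition xi (n : nat) : nat := ex_minn (bounds_unique_solutions_exists n).

Definition diophantine_zero (n m : nat) (W : {mpoly int[n + m]})
    (a : n.-tuple nat) (x : m.-tuple nat) : Prop :=
  (W.@[fun i => (tnth [tuple of a ++ x] i)%:Z] = 0)%R.

Definition single_fold_diophantine (n : nat) (M : n.-tuple nat -> Prop) : Prop :=
  exists (m : nat) (W : {mpoly int[n + m]}),
    (forall a : n.-tuple nat,
       M a <-> exists x : m.-tuple nat, diophantine_zero W a x) /\
    (forall (a : n.-tuple nat) (x y : m.-tuple nat),
       diophantine_zero W a x -> diophantine_zero W a y -> x = y).

(* Only the values of [f] at positive arguments belong to the graph: [f] stands
   for a function on the positive integers and its value at 0 is junk. *)
Definition pos_graph (f : nat -> nat) (t : 2.-tuple nat) : Prop :=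
  exists a : nat, 0 < a /\ t = [tuple a; f a].

(* Main.v *)
Require Import Defs.
From mathcomp Require Import all_boot.
From mathcomp Require Import ssralg ssrint boolp mpoly.
From mathcomp Require Import zify ring.

Set Implicit Arguments.
Unset Strict Implicit.
Unset Printing Implicit Defensive.

(** Let W(a, b, x_1, ..., x_m) = 0 be the single-fold representation of f.
For large n one wants a system of equations in n variables whose unique
positive solution contains the value f n + 1.

It is convenient to forget the system and keep only the finite set A of values
of its solution, imposing every relation a * b = c and a + 1 = c that holds in
A. A solution of this maximal system is a positive map h on A compatible with
the products and successors that stay in A, a partial homomorphism; hence
uniqueness of the solution says that A is rigid, that is, h must be the
identity. So [rigid_leq_xi] reduces the theorem to building, for n large, a
rigid set of at most n positive integers that contains 1 and f n + 1.

Unknowns that range over the natural numbers are shifted by one: rho_i is the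
i-th unknown plus 1. Substituting rho_i - 1 in W and separating signs gives
W = P(rho) - Q(rho) with P and Q polynomial expressions with positive integer
coefficients ([int_tracked_meval]). Products are directly available in A, and a
sum z = x + y of positive integers is characterised by the identity
(z x + 1)(z y + 1) = z^2 (x y + 1) + 1 ([eq_sum_by_products]). Hence, adding to
A a number of intermediate values that depends on W only, every partial
homomorphism h satisfies h(P(rho)) = P(h(rho)), and likewise for Q.

The value n + 1 is forced by the set 1, 2, ..., k, 2k, 2k + 1 with
k = (n + 1)/2 rounded down ([numeral_trace_fixed]). It has about n/2 elements,
so for n large there is room left for the boundedly many values above. Finally
let rho be the shifted solution of W = 0 for (n, f n), and h a partial
homomorphism. From P(rho) = Q(rho) one gets P(h(rho)) = Q(h(rho)), so h(rho)
also gives a zero of W, with the same first coordinate n. Since W represents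
the graph of f and is single-fold, h(rho) = rho; every other element of A is
computed from rho, so h is the identity and A is rigid. *)

(** * Rigid sets of positive integers *)

Definition partial_hom (A : seq nat) (h : nat -> nat) : Prop :=
  [/\ {in A, forall a, 0 < h a},
      {in A &, forall a b, a * b \in A -> h (a * b) = h a * h b}
    & {in A, forall a, a.+1 \in A -> h a.+1 = (h a).+1}].

Definition rigid (A : seq nat) : Prop :=
  forall h, partial_hom A h -> {in A, h =1 id}.

Lemma partial_hom_sub (A B : seq nat) (h : nat -> nat) :
  {subset B <= A} -> partial_hom A h -> partial_hom B h.
Proof.
move=> sBA [h_gt0 hM hS]; split=> [a /sBA /h_gt0 //|a b /sBA aA /sBA bA /sBA|].
  exact: hM.
by move=> a /sBA aA /sBA; apply: hS.
Qed.

(** 1 is the only positive solution of x * x = x. *)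
Lemma partial_hom1 (A : seq nat) (h : nat -> nat) :
  partial_hom A h -> 1 \in A -> h 1 = 1.
Proof.
move=> [h_gt0 hM _] A1; have := hM 1 1 A1 A1 A1.
by have := h_gt0 1 A1; rewrite mul1n; nia.
Qed.

(** The witnessing system consists of all the equations of B_n satisfied by the
enumeration of A, padded with 1. A solution x of it takes equal values at
positions carrying equal elements of A, because a * 1 = a is one of the
equations; so x factors through a partial homomorphism on A, to which rigidity
applies. *)
Lemma rigid_leq_xi (n : nat) (A : seq nat) :
  all (leq 1) A -> 1 \in A -> size A <= n -> rigid A ->
  {in A, forall a, a <= xi n}.
Proof.
move=> A_gt0 A1 szA rigA a aA.
have ltA b : b \in A -> index b A < n by rewrite -index_mem => /leq_trans; apply.
pose v : {ffun 'I_n -> nat} := [ffun i : 'I_n => nth 1 A i].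
pose S := [set e : Defs.eqn n | `[< eqn_holds v e >]].
have Sv e : reflect (eqn_holds v e) (e \in S) by rewrite inE; apply: asboolP.
have vA i : v i \in A.
  rewrite ffunE; have [lt_iA|le_Ai] := ltnP i (size A); first exact: mem_nth.
  by rewrite nth_default.
have idxP b : b \in A -> exists i, v i = b.
  by move=> bA; exists (Ordinal (ltA b bA)); rewrite ffunE nth_index.
have [i1 vi1] := idxP 1 A1.
have vU : unique (pos_solution S) v.
  split; first by split=> [i|e /Sv//]; apply: (allP A_gt0); apply: vA.
  move=> x [x_gt0 xS].
  have vx e : eqn_holds v e -> eqn_holds x e by move/Sv/xS.
  have x1 : x i1 = 1.
    have /vx /= : eqn_holds v (inl (i1, i1, i1)) by rewrite /= vi1.
    by have := x_gt0 i1; nia.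
  have x_eq i j : v i = v j -> x i = x j.
    move=> vij.
    have /vx /= : eqn_holds v (inl (i, i1, j)) by rewrite /= vi1 vij muln1.
    by rewrite x1 muln1.
  pose h b := if insub (index b A) is Some i then x i else 0.
  have hv i : h (v i) = x i.
    rewrite /h insubT ?ltA// => lt_i; apply: x_eq.
    by rewrite [LHS]ffunE nth_index.
  have h_hom : partial_hom A h.
    split=> [b /idxP[i <-]|b c /idxP[i <-] /idxP[j <-] /idxP[k vk]|].
    - by rewrite hv.
    - by rewrite -vk !hv; apply/esym/(vx (inl (i, j, k))).
    move=> b /idxP[i <-] /idxP[k vk]; rewrite -vk !hv -addn1.
    have /vx // : eqn_holds v (inr (i, k)) by rewrite /= addn1.
  by apply/ffunP => i; rewrite -hv rigA.
have [i <-] := idxP a aA.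
rewrite /xi; case: ex_minnP => b /asboolP[_ b_bound] _.
by have /andP[] := b_bound S v vU i.
Qed.

(** * Sums from products and successors *)

(** After expansion, both sides share z^2 x y + 1, and what remains is
z (x + y) = z^2. *)
Lemma eq_sum_by_products (x y z : nat) : 0 < z ->
  ((z * x).+1 * (z * y).+1 == (z * z * (x * y).+1).+1) = (z == x + y).
Proof.
move=> z_gt0; rewrite -[RHS](eqn_pmul2l z_gt0).
have -> : (z * x).+1 * (z * y).+1 = (z * z * (x * y) + z * (x + y)).+1 by ring.
by rewrite mulnS [z * z + _]addnC eqSS eqn_add2l.
Qed.

(** The subterms, x and y aside, of the identity of [eq_sum_by_products] at
z = x + y; the two sides themselves are the same number, listed once. *)
Definition sum_trace (x y : nat) : seq nat :=
  let z := x + y in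
  [:: z; z * x; (z * x).+1; z * y; (z * y).+1; z * z; x * y; (x * y).+1;
      z * z * (x * y).+1; (z * z * (x * y).+1).+1].

Lemma sum_trace_gt0 (x y : nat) : 0 < x -> 0 < y -> all (leq 1) (sum_trace x y).
Proof. by move=> x_gt0 y_gt0; rewrite /= !muln_gt0 !addn_gt0 x_gt0 y_gt0. Qed.

(** The image under h of the identity of [eq_sum_by_products] is the same
identity between h z, h x and h y, which forces h z = h x + h y. *)
Lemma partial_hom_sum (A : seq nat) (h : nat -> nat) (x y : nat) :
    partial_hom A h -> x \in A -> y \in A -> 0 < x + y ->
    {subset sum_trace x y <= A} ->
  h (x + y) = h x + h y /\
  (h x = x -> h y = y -> {in sum_trace x y, h =1 id}).
Proof.
move=> [h_gt0 hM hS] xA yA; set z := x + y => z_gt0 sA.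
have zA : z \in A by apply: sA; rewrite !inE eqxx.
have zxA : z * x \in A by apply: sA; rewrite !inE eqxx !orbT.
have zx1A : (z * x).+1 \in A by apply: sA; rewrite !inE eqxx !orbT.
have zyA : z * y \in A by apply: sA; rewrite !inE eqxx !orbT.
have zy1A : (z * y).+1 \in A by apply: sA; rewrite !inE eqxx !orbT.
have zzA : z * z \in A by apply: sA; rewrite !inE eqxx !orbT.
have xyA : x * y \in A by apply: sA; rewrite !inE eqxx !orbT.
have xy1A : (x * y).+1 \in A by apply: sA; rewrite !inE eqxx !orbT.
have pA : z * z * (x * y).+1 \in A by apply: sA; rewrite !inE eqxx !orbT.
have p1A : (z * z * (x * y).+1).+1 \in A by apply: sA; rewrite !inE eqxx !orbT.
have prodE : (z * x).+1 * (z * y).+1 = (z * z * (x * y).+1).+1.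
  by apply/eqP; rewrite eq_sum_by_products.
have hprodE : h (z * z * (x * y).+1).+1 = (h z * h x).+1 * (h z * h y).+1.
  by rewrite -prodE hM ?prodE // !hS // !hM.
have hz : h z = h x + h y.
  apply/eqP; rewrite -eq_sum_by_products; last exact: h_gt0.
  by rewrite -hprodE hS // hM // hM // hS // hM.
split=> // hx hy; have {}hz : h z = z by rewrite hz hx hy.
suff /allP fixed : all (fun a => h a == a) (sum_trace x y) by move=> a /fixed/eqP.
by rewrite /= !hS // !hM // !hS // !hM // hz hx hy !eqxx.
Qed.

(** * Functions evaluated by boundedly many steps *)

(** [T] lists the intermediate values of a computation of [F rho] from the
entries of [rho] by products and successors. The bound [c] on the number of
steps is uniform in [rho]: this is what leaves the size of the final rigid set
below n. The last clause is what turns a homomorphism fixing [rho] into one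
fixing the whole computation. *)
Definition tracked (I : Type) (F : (I -> nat) -> nat) : Prop :=
  exists c : nat, forall rho : I -> nat, (forall i, 0 < rho i) ->
  exists T : seq nat,
    [/\ size T <= c, all (leq 1) T, F rho \in T
      & forall h, partial_hom T h ->
          h (F rho) = F (h \o rho) /\
          ((forall i, h (rho i) = rho i) -> {in T, h =1 id})].

Lemma tracked_var (I : Type) (i : I) : tracked (fun rho => rho i).
Proof.
exists 1 => rho rho_gt0; exists [:: rho i]; split=> //=.
- by rewrite rho_gt0.
- by rewrite inE.
by move=> h _; split=> // h_rho a; rewrite inE => /eqP->; rewrite h_rho.
Qed.

Lemma tracked1 (I : Type) : tracked (fun _ : I -> nat => 1).
Proof.
exists 1 => rho rho_gt0; exists [:: 1]; split=> // h h_hom.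
have h1 := partial_hom1 h_hom isT.
by split=> // _ a; rewrite inE => /eqP->.
Qed.

Lemma tracked_mul (I : Type) (F G : (I -> nat) -> nat) :
  tracked F -> tracked G -> tracked (fun rho => F rho * G rho).
Proof.
move=> [c Fc] [d Gd]; exists (c + d).+1 => rho rho_gt0.
have [T [szT T_gt0 FT hT]] := Fc rho rho_gt0.
have [U [szU U_gt0 GU hU]] := Gd rho rho_gt0.
exists (F rho * G rho :: T ++ U); split.
- by rewrite /= size_cat; lia.
- by rewrite /= all_cat T_gt0 U_gt0 muln_gt0 (allP T_gt0) ?(allP U_gt0).
- exact: mem_head.
move=> h h_hom; have [_ hM _] := h_hom.
have [|hF h_id_T] := hT h.
  by apply: partial_hom_sub h_hom => a aT; rewrite inE mem_cat aT orbT.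
have [|hG h_id_U] := hU h.
  by apply: partial_hom_sub h_hom => a aU; rewrite inE mem_cat aU !orbT.
have hFG : h (F rho * G rho) = h (F rho) * h (G rho).
  by apply: hM; rewrite inE ?mem_cat ?FT ?GU ?eqxx ?orbT.
split=> [|h_rho a]; first by rewrite hFG hF hG.
rewrite inE mem_cat => /or3P[/eqP->||]; [|exact: h_id_T|exact: h_id_U].
by rewrite hFG h_id_T // h_id_U.
Qed.

Lemma tracked_add (I : Type) (F G : (I -> nat) -> nat) :
  tracked F -> tracked G -> tracked (fun rho => F rho + G rho).
Proof.
move=> [c Fc] [d Gd]; exists (10 + (c + d)) => rho rho_gt0.
have [T [szT T_gt0 FT hT]] := Fc rho rho_gt0.
have [U [szU U_gt0 GU hU]] := Gd rho rho_gt0.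
exists (sum_trace (F rho) (G rho) ++ (T ++ U)); split.
- by rewrite /= size_cat; lia.
- rewrite all_cat sum_trace_gt0; [|exact: (allP T_gt0)|exact: (allP U_gt0)].
  by rewrite all_cat T_gt0.
- exact: mem_head.
move=> h h_hom.
have [|hF h_id_T] := hT h.
  by apply: partial_hom_sub h_hom => a aT; rewrite !mem_cat aT orbT.
have [|hG h_id_U] := hU h.
  by apply: partial_hom_sub h_hom => a aU; rewrite !mem_cat aU !orbT.
have [||||hFG h_id_sum] := partial_hom_sum h_hom (x := F rho) (y := G rho).
- by rewrite !mem_cat FT orbT.
- by rewrite !mem_cat GU !orbT.
- by rewrite addn_gt0 (allP T_gt0).
- by move=> a aS; rewrite mem_cat aS.
split=> [|h_rho a]; first by rewrite hFG hF hG.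
rewrite !mem_cat => /or3P[||]; [|exact: h_id_T|exact: h_id_U].
by apply: h_id_sum; [apply: h_id_T|apply: h_id_U].
Qed.

Lemma tracked_const (I : Type) (k : nat) : tracked (fun _ : I -> nat => k.+1).
Proof.
elim: k => [|k IHk]; first exact: tracked1.
have := tracked_add IHk (tracked1 I).
by congr tracked; apply: funext => rho; rewrite addn1.
Qed.

(** * Integer polynomials as differences of tracked functions *)

Section DifferenceOfTracked.
Import GRing.Theory.
Local Open Scope ring_scope.

Definition int_tracked (I : Type) (F : (I -> nat) -> int) : Prop :=
  exists P Q : (I -> nat) -> nat,
    [/\ tracked P, tracked Q & forall rho, F rho = (P rho)%:Z - (Q rho)%:Z].

(** Tracked functions are positive at positive arguments, hence the shifts by
one. *)
Lemma int_tracked_const (I : Type) (k : int) :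
  int_tracked (fun _ : I -> nat => k).
Proof.
case: k => k.
  exists (fun=> k.+1), (fun=> 1%N).
  by split=> [||_]; [apply: tracked_const|apply: tracked1|lia].
exists (fun=> 1%N), (fun=> k.+2).
by split=> [||_]; [apply: tracked1|apply: tracked_const|rewrite NegzE; lia].
Qed.

Lemma int_tracked_pred (I : Type) (i : I) :
  int_tracked (fun rho => (rho i)%:Z - 1).
Proof.
by exists (fun rho => rho i), (fun=> 1%N);
  split=> //; [apply: tracked_var|apply: tracked1].
Qed.

Lemma int_tracked_add (I : Type) (F G : (I -> nat) -> int) :
  int_tracked F -> int_tracked G -> int_tracked (fun rho => F rho + G rho).
Proof.
move=> [P [Q [tP tQ FE]]] [P' [Q' [tP' tQ' GE]]].
exists (fun rho => P rho + P' rho)%N, (fun rho => Q rho + Q' rho)%N.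
by split=> [||rho]; [apply: tracked_add..|rewrite FE GE; lia].
Qed.

Lemma int_tracked_mul (I : Type) (F G : (I -> nat) -> int) :
  int_tracked F -> int_tracked G -> int_tracked (fun rho => F rho * G rho).
Proof.
move=> [P [Q [tP tQ FE]]] [P' [Q' [tP' tQ' GE]]].
exists (fun rho => P rho * P' rho + Q rho * Q' rho)%N.
exists (fun rho => P rho * Q' rho + Q rho * P' rho)%N.
split=> [||rho]; [by apply: tracked_add; apply: tracked_mul..|].
by rewrite FE GE; nia.
Qed.

(** The substitution of rho_i - 1 translates unknowns in the natural numbers
into the positive unknowns for which sums can be tracked. *)
Lemma int_tracked_meval (k : nat) (W : {mpoly int[k]}) :
  int_tracked (fun rho : 'I_k -> nat => W.@[fun i => (rho i)%:Z - 1]).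
Proof.
under eq_fun => rho do rewrite mevalE.
elim: (msupp W : seq _) => [|m s IHs].
  by under eq_fun => rho do rewrite big_nil; apply: int_tracked_const.
under eq_fun => rho do rewrite big_cons.
apply: int_tracked_add IHs; apply: int_tracked_mul; first exact: int_tracked_const.
elim: (index_enum _) => [|i r IHr].
  by under eq_fun => rho do rewrite big_nil; apply: int_tracked_const.
under eq_fun => rho do rewrite big_cons.
apply: int_tracked_mul IHr; elim: (m i) => [|d IHd].
  by under eq_fun => rho do rewrite expr0; apply: int_tracked_const.
under eq_fun => rho do rewrite exprS.
by apply: int_tracked_mul IHd; apply: int_tracked_pred.
Qed.

End DifferenceOfTracked.

(** * Forcing the value n with about n/2 elements *)

(** Counting up to n by successors alone would use n elements; doubling half of
n once saves enough of them. Both possible parities of n are included. *)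
Definition numeral_trace (n : nat) : seq nat :=
  iota 1 n./2 ++ [:: n./2.*2; n./2.*2.+1].

Lemma mem_numeral_trace (n : nat) : n \in numeral_trace n.
Proof.
rewrite mem_cat !inE -[X in (X == _) || _]odd_double_half.
by rewrite -[X in _ || (X == _)]odd_double_half; case: (odd n); rewrite !eqxx !orbT.
Qed.

Lemma numeral_trace_gt0 (n : nat) : 1 < n -> all (leq 1) (numeral_trace n).
Proof.
move=> n_gt1; rewrite all_cat /= double_gt0 half_gt0 n_gt1 !andbT.
by apply/allP=> a; rewrite mem_iota => /andP[].
Qed.

(** The bound on n ensures that 2 is among the elements up to n/2, so that the
product 2 * (n/2) is one of the relations. *)
Lemma numeral_trace_fixed (n : nat) (h : nat -> nat) :
  3 < n -> partial_hom (numeral_trace n) h -> {in numeral_trace n, h =1 id}.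
Proof.
move=> n_gt3 h_hom; rewrite /numeral_trace in h_hom *; set k := n./2 in h_hom *.
have k_gt1 : 1 < k by rewrite /k; lia.
set A := _ ++ _ in h_hom *; have [_ hM hS] := h_hom.
have lowA j : 0 < j -> j <= k -> j \in A.
  by move=> j_gt0 le_jk; rewrite mem_cat mem_iota j_gt0 add1n ltnS le_jk.
have h_low j : 0 < j -> j <= k -> h j = j.
  elim: j => // -[|j] IHj _ le_jk.
    by apply: partial_hom1 h_hom _; apply: lowA.
  by rewrite hS ?IHj ?lowA // ltnW.
have doubleA : k.*2 \in A by rewrite mem_cat !inE eqxx orbT.
have h_double : h k.*2 = k.*2.
  by rewrite -muln2 hM ?muln2 // ?h_low ?muln2 ?lowA // ltnW.
move=> a; rewrite mem_cat mem_iota add1n ltnS !inE.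
case/or3P=> [/andP[]|/eqP->|/eqP->] //; first exact: h_low.
by rewrite hS ?h_double // mem_cat !inE eqxx !orbT.
Qed.

(** * Domination by the bound on unique solutions *)

Theorem theorem5 (f : nat -> nat) (f_pos : forall n : nat, 0 < n -> 0 < f n)
    (f_sfd : single_fold_diophantine (pos_graph f)) :
  exists m : nat, 0 < m /\ forall n : nat, m < n -> f n < xi n.
Proof.
have [m [W [W_graph W_single]]] := f_sfd.
have [P [Q [[cP trP] [cQ trQ] WE]]] := int_tracked_meval W.
have W_zero (a : 2.-tuple nat) (x : m.-tuple nat) (rho : 'I_(2 + m) -> nat) :
    (forall i, rho i = (tnth [tuple of a ++ x] i).+1) ->
  diophantine_zero W a x <-> P rho = Q rho.
  move=> rhoE; rewrite /diophantine_zero.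
  have -> : (fun i => (tnth [tuple of a ++ x] i)%:Z)%R =
            (fun i => (rho i)%:Z - 1)%R by apply: funext => i; rewrite rhoE; lia.
  by rewrite WE; lia.
pose c := cP + cQ + m.
(* The rigid set below has at most (n + 1)/2 + 2 + cP + cQ + (2 + m) elements,
   which is at most n once n > 10 + 2c. *)
exists (10 + c.*2); split=> // n n_large.
have n_gt0 : 0 < n by lia.
have [x Wx] : exists x, diophantine_zero W [tuple n; f n] x.
  by apply/W_graph; exists n.
pose rho i := (tnth [tuple of [tuple n; f n] ++ x] i).+1.
pose i0 : 'I_(2 + m) := lshift m ord0.
pose i1 : 'I_(2 + m) := lshift m (lift ord0 ord0).
have rho0 : rho i0 = n.+1 by rewrite /rho tnth_lshift.
have rho1 : rho i1 = (f n).+1 by rewrite /rho tnth_lshift.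
have PQ : P rho = Q rho by apply/(W_zero _ _ rho (fun=> erefl)).
have [T [szT T_gt0 PT hT]] := trP rho (fun=> isT).
have [U [szU U_gt0 QU hU]] := trQ rho (fun=> isT).
pose A := numeral_trace n.+1 ++ T ++ U ++ codom rho.
have rhoA i : rho i \in A by rewrite !mem_cat codom_f !orbT.
rewrite -rho1; apply: (@rigid_leq_xi n A) => //.
- rewrite all_cat numeral_trace_gt0 //= !all_cat.
  by rewrite T_gt0 U_gt0; apply/allP=> _ /codomP[i ->].
- by rewrite mem_cat mem_cat mem_iota; lia.
- by rewrite !size_cat size_iota size_codom card_ord /=; lia.
move=> h h_hom.
have numeral_id : {in numeral_trace n.+1, h =1 id}.
  apply: numeral_trace_fixed; first by lia.
  by apply: partial_hom_sub h_hom => a aN; rewrite mem_cat aN.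
have [|hP T_id] := hT h.
  by apply: partial_hom_sub h_hom => a aT; rewrite !mem_cat aT orbT.
have [|hQ U_id] := hU h.
  by apply: partial_hom_sub h_hom => a aU; rewrite !mem_cat aU !orbT.
(* P (h \o rho) = Q (h \o rho), so the unshifted h \o rho is a zero of W; its
   first coordinate is n by the numeral, so it lies over (n, f n), where the
   zero is unique. *)
have rho_id i : h (rho i) = rho i.
  have [h_gt0 _ _] := h_hom.
  pose a' := [tuple (h (rho (lshift m j))).-1 | j < 2].
  pose x' := [tuple (h (rho (rshift 2 j))).-1 | j < m].
  have hrhoE j : (h \o rho) j = (tnth [tuple of a' ++ x'] j).+1.
    case: (split_ordP j) => j' ->.
      by rewrite tnth_lshift tnth_mktuple prednK // h_gt0.
    by rewrite tnth_rshift tnth_mktuple prednK // h_gt0.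
  have Wx' : diophantine_zero W a' x'.
    by apply/(W_zero _ _ _ hrhoE); rewrite -hP -hQ PQ.
  have a'E : a' = [tuple n; f n].
    have [b [_ a'b]] : pos_graph f a' by apply/W_graph; exists x'.
    have nb : n = b.
      have := congr1 (fun t => tnth t ord0) a'b.
      by rewrite tnth_mktuple -/i0 rho0 numeral_id ?mem_numeral_trace.
    by rewrite a'b nb.
  have x'E : x' = x by apply: W_single Wx; rewrite -a'E.
  by rewrite -[LHS]/((h \o rho) i) hrhoE a'E x'E.
move=> a; rewrite mem_cat => /orP[|]; first exact: numeral_id.
rewrite !mem_cat => /or3P[||/codomP[i ->]]; last exact: rho_id.
- exact: T_id.
- exact: U_id.
Qed.
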